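(* Let $\mathbb F$ be a field, let $\alpha\in\mathbb F$ with $\alpha\ne0,-1$, let $L=L_3(\alpha)$ and $G=\operatorname{Aut}(L)$. If $\alpha\ne1$, then $\Xi(G)$ consists of all nondegenerate matrices of the form $$\text{(A)}\qquad\begin{pmatrix}\alpha_1&0&0\\ \dfrac{\beta_2-\alpha_1}{1+\alpha}&\beta_2&0\\ \alpha_3&\beta_3&\alpha_1\beta_2\end{pmatrix},\qquad \alpha_1,\beta_2\in\mathbb F^{\times},\ \alpha_3,\beta_3\in\mathbb F.$$ Moreover, $G$ contains a normal subgroup isomorphic to $\mathbb F^{+}\times\mathbb F^{+}$ and a subgroup isomorphic to $\mathbb F^{\times}\times\mathbb F^{\times}$, and $G$ is their semidirect product. If $\alpha=1$, then $\operatorname{char}\mathbb F\ne2$ and $\Xi(G)$ consists of the matrices of the form (A) together with all nondegenerate matrices of the form $$\begin{pmatrix}\alpha_1&2\alpha_1&0\\ \alpha_2&-\alpha_1&0\\ \alpha_3&\beta_3&\alpha_1(\alpha_1+2\alpha_2)\end{pmatrix},\qquad \alpha_1,\alpha_2,\alpha_3,\beta_3\in\mathbb F,\ \alpha_1(\alpha_1+2\alpha_2)\ne0.$$ In this case $G$ is a semidirect product of a normal subgroup isomorphic to $\mathbb F^{+}\times\mathbb F^{+}$ and a subgroup which is a semidirect product of $\mathbb F^{\times}\times\mathbb F^{\times}$ by a group of order two, where the nontrivial element of the latter group interchanges the two multiplicative factors.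
   Context: A left Leibniz algebra over $\mathbb F$ is a vector space with a bilinear product satisfying $[x,[y,z]]=[[x,y],z]+[y,[x,z]]$. $L_3(\alpha)$ is the three-dimensional left Leibniz algebra over $\mathbb F$ with basis $a_1,a_2,a_3$ and nonzero products $[a_1,a_1]=[a_2,a_1]=a_3$, $[a_1,a_2]=\alpha a_3$ (all other products of basis elements are zero). $\operatorname{Aut}(L)$ is the group of invertible linear maps $f:L\to L$ with $f([x,y])=[f(x),f(y)]$. $\Xi:\operatorname{Aut}(L)\to GL_3(\mathbb F)$ is the monomorphism sending $f$ to its matrix in the basis $a_1,a_2,a_3$, the $j$-th column being the coordinates of $f(a_j)$. $\mathbb F^{+}$ and $\mathbb F^{\times}$ denote the additive and multiplicative groups of $\mathbb F$. ''A semidirect product of $A$ by (or and) $B$'' with $A$ named first means that $A$ is normal and $B$ is a complement. *)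

(* Defs.v *)
From HB Require Import structures.
From mathcomp Require Import all_boot all_order all_algebra.
From mathcomp Require Import boolp classical_sets ring.

Set Implicit Arguments.
Unset Strict Implicit.
Unset Printing Implicit Defensive.

Import GRing.Theory.
Local Open Scope ring_scope.

HB.mixin Record Lmodule_isLeftLeibniz (F : fieldType) L of GRing.Lmodule F L := {
  lbr : L -> L -> L;
  lbr_linearl : forall y : L, linear (lbr^~ y);
  lbr_linearr : forall x : L, linear (lbr x);
  lbr_leibniz : forall x y z : L,
    lbr x (lbr y z) = lbr (lbr x y) z + lbr y (lbr x z)
}.

#[short(type="leibnizType")]
HB.structure Definition LeftLeibniz (F : fieldType) :=
  {L of Lmodule_isLeftLeibniz F L & GRing.Lmodule F L}.

Section Aut.
Variables (F : fieldType) (L : leibnizType F).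

Definition is_aut (f : L -> L) : Prop :=
  [/\ linear f, bijective f & {morph f : x y / lbr x y}].

(* The proof is stored as a boolean so that automorphisms form a subType of
   L -> L: they are equal as soon as the underlying functions are. *)
Record aut : Type := Aut {aut_val :> L -> L; _ : `[< is_aut aut_val >]}.

HB.instance Definition _ := [isSub for aut_val].
HB.instance Definition _ := [Choice of aut by <:].

Lemma autP (f : aut) : is_aut f.
Proof. exact/asboolP/(valP f). Qed.

Lemma aut_inj (f g : aut) : f =1 g -> f = g.
Proof. by move=> fg; apply/val_inj/funext. Qed.

Definition mk_aut (f : L -> L) (fP : is_aut f) : aut := Aut (asboolT fP).

Lemma is_aut_id : is_aut id.
Proof. by split=> //; exists id. Qed.

Lemma is_aut_comp (f g : L -> L) : is_aut f -> is_aut g -> is_aut (f \o g).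
Proof.
move=> [fL fB fM] [gL gB gM]; split; last by move=> x y /=; rewrite gM fM.
- by move=> a x y /=; rewrite gL fL.
- exact: bij_comp.
Qed.

Definition aut_one : aut := mk_aut is_aut_id.

Definition aut_mul (f g : aut) : aut := mk_aut (is_aut_comp (autP f) (autP g)).

Lemma aut_inv_ex (f : aut) :
  exists g : aut, aut_mul g f = aut_one /\ aut_mul f g = aut_one.
Proof.
have [fL [g fK gK] fM] := autP f.
have gP : is_aut g.
  split; last by move=> x y; apply: (can_inj fK); rewrite fM !gK.
  - by move=> a x y; apply: (can_inj fK); rewrite fL !gK.
  - by exists f.
exists (mk_aut gP).
by split; apply: aut_inj => x /=; [apply: fK | apply: gK].
Qed.

Definition aut_inv (f : aut) : aut := projT1 (cid (aut_inv_ex f)).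

Lemma aut_mulA : associative aut_mul.
Proof. by move=> f g h; apply: aut_inj. Qed.
Lemma aut_mul1l : left_id aut_one aut_mul.
Proof. by move=> f; apply: aut_inj. Qed.
Lemma aut_mul1r : right_id aut_one aut_mul.
Proof. by move=> f; apply: aut_inj. Qed.
Lemma aut_mulVl : left_inverse aut_one aut_inv aut_mul.
Proof. by move=> f; rewrite /aut_inv; case: cid => g []. Qed.
Lemma aut_mulVr : right_inverse aut_one aut_inv aut_mul.
Proof. by move=> f; rewrite /aut_inv; case: cid => g []. Qed.

HB.instance Definition _ :=
  isGroup.Build aut aut_mulA aut_mul1l aut_mul1r aut_mulVl aut_mulVr.

Lemma aut_oneE x : (1%g : aut) x = x. Proof. by []. Qed.
Lemma aut_mulE (f g : aut) x : (f * g)%g x = f (g x). Proof. by []. Qed.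

End Aut.

Section L3.
Variable F : fieldType.

(* L3_basis k is the basis vector a_{k+1}. *)
Definition L3_basis (k : 'I_3) : 'cV[F]_3 := delta_mx k 0.

Definition L3_table (alpha : F) (i j : 'I_3) : 'cV[F]_3 :=
  match nat_of_ord i, nat_of_ord j with
  | 0%N, 0%N | 1%N, 0%N => L3_basis 2
  | 0%N, 1%N => alpha *: L3_basis 2
  | _, _ => 0
  end.

Definition L3_bracket (alpha : F) (x y : 'cV[F]_3) : 'cV[F]_3 :=
  \sum_(i < 3) \sum_(j < 3) (x i 0 * y j 0) *: L3_table alpha i j.

Lemma L3_bracketE (alpha : F) (x y : 'cV[F]_3) :
  L3_bracket alpha x y =
  (x 0 0 * y 0 0 + x 1 0 * y 0 0 + alpha * (x 0 0 * y 1 0)) *: L3_basis 2.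
Proof.
rewrite /L3_bracket !big_ord_recl !big_ord0 /L3_table /=.
rewrite !scaler0 !addr0 !scalerA -!scalerDl; congr (_ *: _).
have -> : lift ord0 ord0 = 1 :> 'I_3 by apply: val_inj.
rewrite -[ord0]/(0 : 'I_3); ring.
Qed.

Lemma L3_bracket_basis (alpha : F) i j :
  L3_bracket alpha (L3_basis i) (L3_basis j) = L3_table alpha i j.
Proof.
rewrite /L3_bracket (bigD1 i) //= (bigD1 j) //= !big1 ?addr0.
- by rewrite !mxE !eqxx mulr1 scale1r.
- move=> k ki; apply: big1 => l _.
  by rewrite mxE (negPf ki) mul0r scale0r.
- by move=> k ki; rewrite !mxE eqxx (negPf ki) mulr0 scale0r.
Qed.

Definition L3 (alpha : F) : Type := 'cV[F]_3.

Variable alpha : F.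

HB.instance Definition _ := GRing.Lmodule.on (L3 alpha).

Fact L3_linearl (y : L3 alpha) :
  linear ((L3_bracket alpha : L3 alpha -> L3 alpha -> L3 alpha)^~ y).
Proof.
move=> a u v; rewrite !L3_bracketE !mxE scalerA -scalerDl; congr (_ *: _); ring.
Qed.

Fact L3_linearr (x : L3 alpha) :
  linear (L3_bracket alpha x : L3 alpha -> L3 alpha).
Proof.
move=> a u v; rewrite !L3_bracketE !mxE scalerA -scalerDl; congr (_ *: _); ring.
Qed.

Fact L3_leibniz (x y z : L3 alpha) :
  L3_bracket alpha x (L3_bracket alpha y z) =
  L3_bracket alpha (L3_bracket alpha x y) z +
  L3_bracket alpha y (L3_bracket alpha x z) :> L3 alpha.
Proof.
rewrite !L3_bracketE !mxE -scalerDl; congr (_ *: _).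
by rewrite /= !(mulr0, mul0r, addr0).
Qed.

HB.instance Definition _ :=
  Lmodule_isLeftLeibniz.Build F (L3 alpha) L3_linearl L3_linearr L3_leibniz.

Definition Xi (f : aut (L3 alpha)) : 'M[F]_3 :=
  \matrix_(i, j) f (L3_basis j) i 0.

Lemma XiE (f : aut (L3 alpha)) (x : 'cV[F]_3) : f x = Xi f *m x.
Proof.
have [fL _ _] := autP f.
pose lf := GRing.isLinear.Build F (L3 alpha) (L3 alpha) *:%R f fL.
pose g : {linear L3 alpha -> L3 alpha} := HB.pack (aut_val f) lf.
rewrite -[LHS]/(g x) [x in LHS]matrix_sum_delta linear_sum; apply/colP => i.
rewrite summxE !mxE; apply: eq_bigr => j _.
by rewrite big_ord1 linearZ !mxE mulrC.
Qed.

Lemma Xi1 : Xi 1%g = 1%:M.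
Proof. by apply/matrixP => i j; rewrite !mxE /= eqxx andbT. Qed.

Lemma XiM (f g : aut (L3 alpha)) : Xi (f * g)%g = Xi f *m Xi g.
Proof.
apply/matrixP => i j; rewrite mxE aut_mulE XiE mxE [RHS]mxE.
by apply: eq_bigr => k _; rewrite [Xi g k j]mxE.
Qed.

Lemma Xi_unit (f : aut (L3 alpha)) : Xi f \in unitmx.
Proof.
have /mulmx1_unit[] // : Xi f *m Xi f^-1%g = 1%:M.
by rewrite -XiM mulgV Xi1.
Qed.

Lemma Xi_inj : injective Xi.
Proof. by move=> f g fg; apply: aut_inj => x; rewrite !XiE fg. Qed.

Definition mx3 (rows : seq (seq F)) : 'M[F]_3 :=
  \matrix_(i, j) (nth [::] rows i)`_j.

Definition L3_matA (a1 b2 a3 b3 : F) : 'M[F]_3 :=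
  mx3 [:: [:: a1                       ; 0  ; 0      ];
          [:: (b2 - a1) / (1 + alpha)  ; b2 ; 0      ];
          [:: a3                       ; b3 ; a1 * b2]].

Definition L3_matsA : set 'M[F]_3 :=
  [set M | M \in unitmx /\
    exists a1 b2 a3 b3, [/\ a1 != 0, b2 != 0 & M = L3_matA a1 b2 a3 b3]].

End L3.

Section MatB.
Variable F : fieldType.

Definition L3_matB (a1 a2 a3 b3 : F) : 'M[F]_3 :=
  mx3 [:: [:: a1 ; 2 * a1 ; 0                 ];
          [:: a2 ; - a1   ; 0                 ];
          [:: a3 ; b3     ; a1 * (a1 + 2 * a2)]].

Definition L3_matsB : set 'M[F]_3 :=
  [set M | M \in unitmx /\
    exists a1 a2 a3 b3, a1 * (a1 + 2 * a2) != 0 /\ M = L3_matB a1 a2 a3 b3].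

End MatB.

Section Units.
Variable R : unitRingType.

(* The unit group of R; {unit R} in the library requires R to be finite. *)
Record units : Type := Units {units_val :> R; _ : units_val \is a GRing.unit}.

HB.instance Definition _ := [isSub for units_val].
HB.instance Definition _ := [Choice of units by <:].

Definition units_one : units := Units (unitr1 R).

Fact units_mul_subproof (u v : units) : (u : R) * (v : R) \is a GRing.unit.
Proof. by rewrite (unitrMr _ (valP u)) (valP v). Qed.
Definition units_mul (u v : units) : units := Units (units_mul_subproof u v).

Fact units_inv_subproof (u : units) : (u : R)^-1 \is a GRing.unit.
Proof. by rewrite unitrV (valP u). Qed.
Definition units_inv (u : units) : units := Units (units_inv_subproof u).

Fact units_mulA : associative units_mul.
Proof. by move=> u v w; apply/val_inj/mulrA. Qed.
Fact units_mul1l : left_id units_one units_mul.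
Proof. by move=> u; apply/val_inj/mul1r. Qed.
Fact units_mul1r : right_id units_one units_mul.
Proof. by move=> u; apply/val_inj/mulr1. Qed.
Fact units_mulVl : left_inverse units_one units_inv units_mul.
Proof. by move=> u; apply/val_inj/(mulVr (valP u)). Qed.
Fact units_mulVr : right_inverse units_one units_inv units_mul.
Proof. by move=> u; apply/val_inj/(mulrV (valP u)). Qed.

HB.instance Definition _ :=
  isGroup.Build units units_mulA units_mul1l units_mul1r units_mulVl units_mulVr.

End Units.

Definition Fadd (F : fieldType) : groupType := Algebra.to_multiplicative F.
Definition Fmul (F : fieldType) : groupType := units F.

Section Groups.
Local Open Scope group_scope.
Variable G : groupType.
Implicit Types A N H : {pred G}.

(* phi is an isomorphism of the group K onto the subgroup H of G. *)
Definition isom_onto (K : groupType) H (phi : K -> G) : Prop :=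
  [/\ {morph phi : x y / x * y}, injective phi &
      forall g, g \in H <-> exists k, phi k = g].

Definition isog_to H (K : groupType) : Prop := exists phi, @isom_onto K H phi.

Definition normal_in N A : Prop :=
  [/\ group_closed A, group_closed N, {subset N <= A} &
      {in N & A, forall x g, x ^ g \in N}].

Definition complement_in A N H : Prop :=
  [/\ group_closed H, {subset H <= A},
      forall g, g \in N -> g \in H -> g = 1 &
      {in A, forall g, exists n h, [/\ n \in N, h \in H & g = n * h]}].

(* A is the internal semidirect product of its normal subgroup N by H. *)
Definition semidirect A N H : Prop := normal_in N A /\ complement_in A N H.

End Groups.

(* Main.v *)
(* The derived algebra is the line of a_3, so an automorphism has a matrix with
   a 2 x 2 block P, a bottom row (v, z) and zeros elsewhere; preserving the
   bracket only constrains P and z.  Solving these equations gives the families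
   (A) and (B), according to the vanishing of the (1, 2) entry of P.  The
   automorphisms with P = 1 and z = 1 form the normal subgroup F^+ x F^+, and
   those with v = 0 are a complement, which consists of the matrices
   parametrized by the eigenvalues alpha_1, beta_2 of P and, if alpha = 1, of
   their products with an involution exchanging the eigenlines. *)
Require Import Defs.
From mathcomp Require Import all_boot all_order all_algebra.
From mathcomp Require Import boolp classical_sets.
From mathcomp Require Import ring.

Set Implicit Arguments.
Unset Strict Implicit.
Unset Printing Implicit Defensive.

Import GRing.Theory.
Local Open Scope classical_set_scope.
Local Open Scope ring_scope.

(** * Images of group morphisms as subgroups *)

Section GroupImage.
Local Open Scope group_scope.
Variables (K G : groupType) (phi : K -> G).
Hypothesis phiM : {morph phi : x y / x * y}.

(** Subgroups are boolean predicates here, so the existential over a possibly infinite group is made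
    boolean classically. *)
Definition image_pred : {pred G} := fun g => `[< exists k, phi k = g >].

Lemma image_predP g : reflect (exists k, phi k = g) (g \in image_pred).
Proof. exact: asboolP. Qed.

Lemma mem_image_pred k : phi k \in image_pred.
Proof. by apply/image_predP; exists k. Qed.

Lemma morph_id : phi 1 = 1.
Proof. by apply: (mulgI (phi 1)); rewrite -phiM !mulg1. Qed.

Lemma morph_inv k : phi k^-1 = (phi k)^-1.
Proof. by apply: (mulgI (phi k)); rewrite -phiM !mulgV morph_id. Qed.

Lemma group_closed_image : group_closed image_pred.
Proof.
split=> [|_ _ /image_predP[k <-] /image_predP[l <-]].
  by rewrite -morph_id mem_image_pred.
by rewrite -morph_inv -phiM mem_image_pred.
Qed.

Lemma isom_onto_image : injective phi -> isom_onto image_pred phi.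
Proof. by move=> phi_inj; split=> // g; split=> /image_predP. Qed.

End GroupImage.

Lemma ord3_cases (i : 'I_3) : [\/ i = 0, i = 1 | i = 2].
Proof.
by case: i => [[|[|[|//]]] lti];
  [constructor 1 | constructor 2 | constructor 3]; apply: val_inj.
Qed.

(** * Calculus of the block matrices *)

Section BlockMatrices.
Variable F : fieldType.
Implicit Types p s q t r u z : F.

(** The block P has rows (p, s) and (q, t); the row v is (r, u). *)
Definition lmx p s q t r u z : 'M[F]_3 :=
  mx3 [:: [:: p; s; 0]; [:: q; t; 0]; [:: r; u; z]].

Lemma mx3_ext (A B : 'M[F]_3) :
  [/\ A 0 0 = B 0 0, A 0 1 = B 0 1 & A 0 2 = B 0 2] ->
  [/\ A 1 0 = B 1 0, A 1 1 = B 1 1 & A 1 2 = B 1 2] ->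
  [/\ A 2 0 = B 2 0, A 2 1 = B 2 1 & A 2 2 = B 2 2] -> A = B.
Proof.
move=> [A00 A01 A02] [A10 A11 A12] [A20 A21 A22].
by apply/matrixP => i j; case: (ord3_cases i) => ->; case: (ord3_cases j) => ->.
Qed.

Lemma sum3E (f : 'I_3 -> F) : \sum_i f i = f 0 + f 1 + f 2.
Proof.
rewrite !big_ord_recl big_ord0 addr0 addrA.
by congr (f _ + f _ + f _); apply: val_inj.
Qed.

Lemma lmxM p s q t r u z p' s' q' t' r' u' z' :
  lmx p s q t r u z *m lmx p' s' q' t' r' u' z' =
  lmx (p * p' + s * q') (p * s' + s * t') (q * p' + t * q') (q * s' + t * t')
      (r * p' + u * q' + z * r') (r * s' + u * t' + z * u') (z * z').
Proof. by apply: mx3_ext; split; rewrite mxE sum3E !mxE /=; ring. Qed.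

Lemma lmx1 : lmx 1 0 0 1 0 0 1 = 1%:M.
Proof. by apply: mx3_ext; split; rewrite !mxE. Qed.

Lemma lmx_inj p s q t r u z p' s' q' t' r' u' z' :
  lmx p s q t r u z = lmx p' s' q' t' r' u' z' ->
  [/\ p = p', s = s', q = q' & t = t'] /\ [/\ r = r', u = u' & z = z'].
Proof.
move=> /matrixP E; split; split.
- by have := E 0 0; rewrite !mxE.
- by have := E 0 1; rewrite !mxE.
- by have := E 1 0; rewrite !mxE.
- by have := E 1 1; rewrite !mxE.
- by have := E 2 0; rewrite !mxE.
- by have := E 2 1; rewrite !mxE.
- by have := E 2 2; rewrite !mxE.
Qed.

Lemma det_lmx p s q t r u z : \det (lmx p s q t r u z) = (p * t - s * q) * z.
Proof.
rewrite (expand_det_col _ 2) sum3E ![lmx _ _ _ _ _ _ _ _ _]mxE /= !mul0r !add0r.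
rewrite /cofactor (expand_det_row _ 0) !big_ord_recl big_ord0 /cofactor.
rewrite !det_mx11 !mxE /=; ring.
Qed.

Lemma unitmx_lmx p s q t r u z :
  (lmx p s q t r u z \in unitmx) = ((p * t - s * q) * z != 0).
Proof. by rewrite unitmxE det_lmx unitfE. Qed.

End BlockMatrices.

(** * Automorphisms as solutions of polynomial equations *)

Section AutL3.
Variables (F : fieldType) (alpha : F).
Local Notation G := (aut (L3 alpha)).
Implicit Types p s q t r u z : F.

(* The bracket takes values in the line of a_3, so f preserves it as soon as
   [f a_i, f a_j] = f [a_i, a_j] for i, j <= 2, which are these equations. *)
Definition aut_eqs p s q t z :=
  [/\ p * p + q * p + alpha * (p * q) = z,
      s * p + t * p + alpha * (s * q) = z,
      p * s + q * s + alpha * (p * t) = alpha * z &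
      s * s + t * s + alpha * (s * t) = 0].

Lemma Xi_table (f : G) i j k :
  (Xi f *m L3_table alpha i j) k 0 =
  (Xi f 0 i * Xi f 0 j + Xi f 1 i * Xi f 0 j + alpha * (Xi f 0 i * Xi f 1 j))
    * (k == 2)%:R.
Proof.
have [_ _ fM] := autP f.
have := fM (L3_basis F i : L3 alpha) (L3_basis F j : L3 alpha).
rewrite [lbr (L3_basis F i : L3 alpha) _]L3_bracket_basis XiE => ->.
by rewrite [lbr _ _]L3_bracketE !mxE andbT.
Qed.

Lemma mulmx_basis (M : 'M[F]_3) i j : (M *m L3_basis F j) i 0 = M i j.
Proof. by rewrite -colE mxE. Qed.

Lemma Xi_shape (f : G) : exists p s q t r u z,
  [/\ aut_eqs p s q t z, (p * t - s * q) * z != 0 & Xi f = lmx p s q t r u z].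
Proof.
pose M := Xi f.
(* Since a_3 = [a_1, a_1], the last column of M is the bracket of its first column with itself, so
   it vanishes off a_3. *)
have t00 k : M k 2 = (M 0 0 * M 0 0 + M 1 0 * M 0 0 + alpha * (M 0 0 * M 1 0))
    * (k == 2)%:R.
  by rewrite -mulmx_basis -(Xi_table f 0 0 k).
have := Xi_table f 1 0 2; rewrite mulmx_basis eqxx mulr1 => t10.
have := Xi_table f 0 1 2.
rewrite eqxx mulr1 /L3_table /= -scalemxAr mxE mulmx_basis => t01.
have := Xi_table f 1 1 2; rewrite eqxx mulr1 /L3_table /= mulmx0 mxE => t11.
have fE : M = lmx (M 0 0) (M 0 1) (M 1 0) (M 1 1) (M 2 0) (M 2 1) (M 2 2).
  by apply: mx3_ext; split; rewrite [RHS]mxE //= t00 mulr0.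
exists (M 0 0), (M 0 1), (M 1 0), (M 1 1), (M 2 0), (M 2 1), (M 2 2).
split=> //; last by rewrite -(unitmx_lmx _ _ _ _ (M 2 0) (M 2 1)) -fE Xi_unit.
by split; rewrite // [RHS]t00 mulr1.
Qed.

Lemma L3_aut_ex p s q t r u z :
  aut_eqs p s q t z -> (p * t - s * q) * z != 0 ->
  exists f : G, Xi f = lmx p s q t r u z.
Proof.
move=> [E1 E2 E3 E4] Dz; set M := lmx _ _ _ _ _ _ _.
have Mu : M \in unitmx by rewrite unitmx_lmx.
have fP : is_aut ((mulmx M : L3 alpha -> L3 alpha)).
  split.
  - by move=> a x y; rewrite mulmxDr -scalemxAr.
  - by exists (mulmx (invmx M) : L3 alpha -> L3 alpha) => x;
      rewrite ?mulKmx ?mulKVmx.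
  - move=> x y; rewrite ![lbr _ _]L3_bracketE -scalemxAr.
    have Mx (v : 'cV[F]_3) : (M *m v) 0 0 = p * v 0 0 + s * v 1 0
        /\ (M *m v) 1 0 = q * v 0 0 + t * v 1 0.
      by split; rewrite mxE sum3E !mxE /= mul0r addr0.
    have [-> ->] := Mx x; have [-> ->] := Mx y.
    have -> : M *m L3_basis F 2 = z *: L3_basis F 2.
      apply/colP => i; rewrite mulmx_basis.
      by case: (ord3_cases i) => ->; rewrite !mxE /= ?mulr0 ?mulr1.
    rewrite scalerA; congr (_ *: _).
    (* By bilinearity the four products of coordinates of x and y can be treated separately; each
       equation is then substituted in its own term. *)
    transitivity (x 0 0 * y 0 0 * z + x 1 0 * y 0 0 * z
      + x 0 0 * y 1 0 * (alpha * z) + x 1 0 * y 1 0 * 0); first ring.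
    by rewrite -{1}E1 -{1}E2 -E3 -E4; ring.
exists (mk_aut fP); apply/matrixP => i j.
by rewrite mxE -[RHS]mulmx_basis.
Qed.


(** * The normal subgroup of translations and its complement *)

Lemma trans_eqs : aut_eqs 1 0 0 1 1.
Proof. by split; ring. Qed.

Lemma trans_ex r u : exists f : G, Xi f = lmx 1 0 0 1 r u 1.
Proof.
apply: (L3_aut_ex _ _ trans_eqs).
by rewrite !mulr1 mulr0 subr0 oner_neq0.
Qed.

Definition trans (v : Fadd F * Fadd F) : G := projT1 (cid (trans_ex v.1 v.2)).

Lemma Xi_trans v : Xi (trans v) = lmx 1 0 0 1 v.1 v.2 1.
Proof. by rewrite /trans; case: cid. Qed.

Lemma transM : {morph trans : v w / (v * w)%g}.
Proof.
move=> [a b] [c d]; apply: Xi_inj; rewrite XiM !Xi_trans lmxM /=.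
(* The group law of [Fadd F] unfolds to addition in F, which [ring] has to see. *)
rewrite -[(a * c)%g]/((a : F) + (c : F)) -[(b * d)%g]/((b : F) + (d : F)).
by congr lmx; ring.
Qed.

Lemma trans_inj : injective trans.
Proof.
move=> [a b] [c d] /(congr1 (@Xi F alpha)); rewrite !Xi_trans /=.
by case/lmx_inj=> _ [-> -> _].
Qed.

(** These are the automorphisms that map the plane of a_1 and a_2 into itself. *)
Definition bottom_diag : {pred G} :=
  [pred g : G | (Xi g 2 0 == 0) && (Xi g 2 1 == 0)].

Lemma bottom_diagE (g : G) p s q t r u z :
  Xi g = lmx p s q t r u z -> (g \in bottom_diag) = (r == 0) && (u == 0).
Proof. by move=> gE; rewrite inE gE !mxE. Qed.

Lemma bottom_diagP (g : G) : g \in bottom_diag -> exists p s q t z,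
  [/\ aut_eqs p s q t z, (p * t - s * q) * z != 0 & Xi g = lmx p s q t 0 0 z].
Proof.
have [p [s [q [t [r [u [z [e d gE]]]]]]]] := Xi_shape g.
rewrite (bottom_diagE gE) => /andP[/eqP r0 /eqP u0].
by exists p, s, q, t, z; split=> //; rewrite gE r0 u0.
Qed.

Lemma group_closed_bottom_diag : group_closed bottom_diag.
Proof.
have M : {in bottom_diag &, forall g h : G, (g * h)%g \in bottom_diag}.
  move=> g h /bottom_diagP[p [s [q [t [z [_ _ gE]]]]]].
  move=> /bottom_diagP[p' [s' [q' [t' [z' [_ _ hE]]]]]].
  have := XiM g h; rewrite gE hE lmxM => /bottom_diagE->.
  by rewrite !(mul0r, mulr0, addr0) eqxx.
split=> [|g h gH hH].
  by have := Xi1 alpha; rewrite -lmx1 => /bottom_diagE->; rewrite eqxx.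
apply: M => //; have [p [s [q [t [z [_ d hE]]]]]] := bottom_diagP hH.
(* The bottom row of [h * h^-1] is z times that of [h^-1], and z is nonzero. *)
have [p' [s' [q' [t' [r [u [z' [_ _ vE]]]]]]]] := Xi_shape (h^-1)%g.
have : Xi (h * h^-1)%g = 1%:M by rewrite mulgV Xi1.
rewrite XiM hE vE lmxM -lmx1 => /lmx_inj[_ []].
move: d; rewrite mulf_eq0 negb_or => /andP[_ z0].
rewrite !mul0r !add0r => /eqP; rewrite mulf_eq0 (negPf z0) /= => /eqP r0.
move=> /eqP; rewrite mulf_eq0 (negPf z0) /= => /eqP u0 _.
by rewrite (bottom_diagE vE) r0 u0 eqxx.
Qed.

Lemma trans_conj v (g : G) : exists w, (trans v ^ g)%g = trans w.
Proof.
have [p [s [q [t [r [u [z [_ d gE]]]]]]]] := Xi_shape g.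
move: d; rewrite mulf_eq0 negb_or => /andP[_ z0].
(* Comparing bottom rows in [trans v * g = g * trans w] gives z w = v P. *)
exists ((v.1 * p + v.2 * q) / z, (v.1 * s + v.2 * t) / z).
rewrite conjgE; apply: (mulgI g); rewrite mulVKg.
apply: Xi_inj; rewrite !XiM !Xi_trans gE !lmxM /=.
by congr lmx; field.
Qed.

Lemma semidirect_trans : semidirect predT (image_pred trans) bottom_diag.
Proof.
split; split=> //.
- exact: group_closed_image transM.
- move=> _ g /image_predP[v <-] _.
  by have [w ->] := trans_conj v g; apply: mem_image_pred.
- exact: group_closed_bottom_diag.
- move=> _ /image_predP[v <-]; rewrite (bottom_diagE (Xi_trans v)).
  move=> /andP[/eqP v1 /eqP v2].
  by apply: Xi_inj; rewrite Xi_trans v1 v2 lmx1 Xi1.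
move=> g _; have [p [s [q [t [r [u [z [e d gE]]]]]]]] := Xi_shape g.
have [h hE] := L3_aut_ex 0 0 e d.
move: d; rewrite mulf_eq0 negb_or => /andP[d z0].
(* The translation row w must satisfy w P = (r, u); this is Cramer's rule. *)
exists (trans ((r * t - u * q) / (p * t - s * q),
               (u * p - r * s) / (p * t - s * q))), h.
split; first exact: mem_image_pred.
- by rewrite (bottom_diagE hE) eqxx.
by apply: Xi_inj; rewrite XiM gE Xi_trans hE lmxM; congr lmx => /=; field.
Qed.

(** * Solving the equations: the families (A) and (B) *)

Hypothesis alpha_neqN1 : alpha != -1.

Let alpha1_neq0 : 1 + alpha != 0.
Proof. by rewrite addrC addr_eq0. Qed.

(** If s = 0, the second equation gives z = p t, and cancelling p in the first gives t. If s is
    nonzero, the fourth gives s = -(1 + alpha) t. Put w = p + (1 + alpha) q; the first three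
    equations become z = p w, z = - alpha t w and alpha z = - t w. Cancelling w yields p = - alpha t
    and alpha p = - t, so alpha^2 = 1. *)
Lemma aut_eqsP p s q t z : aut_eqs p s q t z -> (p * t - s * q) * z != 0 ->
  [/\ s = 0, q = (t - p) / (1 + alpha) & z = p * t] \/
  [/\ alpha = 1, s = 2 * p, t = - p & z = p * (p + 2 * q)].
Proof.
move=> [E1 E2 E3 E4]; rewrite mulf_eq0 negb_or => /andP[D0 z0].
have [s0|s0] := eqVneq s 0.
  left; split=> //; last by rewrite -E2 s0; ring.
  have p0 : p != 0.
    by apply: contraNneq D0 => p0; rewrite p0 s0; apply/eqP; ring.
  have -> : t = p + (1 + alpha) * q.
    have tp : t * p = z by rewrite -E2 s0; ring.
    by apply: (mulfI p0); rewrite mulrC tp -E1; ring.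
  by field.
have sE : s = - (1 + alpha) * t.
  apply: (mulfI s0); apply/eqP; rewrite -subr_eq0 -E4; apply/eqP; ring.
have t0 : t != 0 by apply: contraNneq s0 => t0; rewrite sE t0 mulr0.
have zE : z = (p + (1 + alpha) * q) * p by rewrite -E1; ring.
have w0 : p + (1 + alpha) * q != 0.
  by apply: contraNneq z0 => w0; rewrite zE w0 mul0r.
have pE : p = - alpha * t.
  by apply: (mulfI w0); rewrite -zE -E2 sE; ring.
have tE : alpha * p = - t.
  apply: (mulfI w0); transitivity (alpha * z); first by rewrite zE; ring.
  by rewrite -E3 sE; ring.
have a1 : alpha = 1.
  have : (alpha - 1) * (1 + alpha) == 0.
    rewrite -(mulIr_eq0 _ (mulIf t0)); apply/eqP.
    transitivity (- (alpha * (- alpha * t)) - t); first ring.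
    by rewrite -pE tE; ring.
  by rewrite mulf_eq0 (negPf alpha1_neq0) orbF subr_eq0 => /eqP.
right; split=> //; rewrite ?pE ?zE ?sE ?pE a1; ring.
Qed.

Lemma aut_eqs_matA x y : aut_eqs x 0 ((y - x) / (1 + alpha)) y (x * y).
Proof. by split; field. Qed.

Lemma Xi_matA x y r u : x != 0 -> y != 0 ->
  exists f : G, Xi f = L3_matA alpha x y r u.
Proof.
move=> x0 y0; apply: (L3_aut_ex _ _ (aut_eqs_matA x y)).
by rewrite mul0r subr0 !mulf_neq0.
Qed.

Lemma range_XiP (M : 'M[F]_3) : range (@Xi F alpha) M <->
  L3_matsA alpha M \/ alpha = 1 /\ L3_matsB M.
Proof.
split=> [[f _ <-]|[]].
- have fu := Xi_unit f.
  have [p [s [q [t [r [u [z [e d fE]]]]]]]] := Xi_shape f.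
  have [[s0 qE zE]|[a1 sE tE zE]] := aut_eqsP e d.
    left; split=> //; exists p, t, r, u.
    move: d; rewrite s0 zE mul0r subr0 => pt0.
    split; last by rewrite fE s0 qE zE.
    - by apply: contraNneq pt0 => ->; rewrite mul0r mul0r.
    - by apply: contraNneq pt0 => ->; rewrite mulr0 mul0r.
  right; split=> //; split=> //; exists p, q, r, u.
  rewrite -zE; split; last by rewrite fE sE tE zE.
  by move: d; rewrite mulf_eq0 negb_or => /andP[].
- move=> [_ [x [y [r [u [x0 y0 ->]]]]]].
  by have [f fE] := Xi_matA r u x0 y0; exists f.
- move=> [a1 [Mu [p [q [r [u [_ ME]]]]]]].
  move: Mu; rewrite ME -/(lmx _ _ _ _ _ _ _) unitmx_lmx => Dz.
  have [|f fE] := L3_aut_ex r u _ Dz; last by exists f.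
  by split; rewrite a1; ring.
Qed.

(** * The torus of simultaneously diagonalizable automorphisms *)

Lemma torus_ex (k : Fmul F * Fmul F) :
  exists f : G, Xi f = L3_matA alpha (units_val k.1) (units_val k.2) 0 0.
Proof. by apply: Xi_matA; rewrite -unitfE; apply: valP. Qed.

Definition torus (k : Fmul F * Fmul F) : G := projT1 (cid (torus_ex k)).

Lemma Xi_torus k : Xi (torus k) =
  lmx (units_val k.1) 0 ((units_val k.2 - units_val k.1) / (1 + alpha))
      (units_val k.2) 0 0 (units_val k.1 * units_val k.2).
Proof. by rewrite /torus; case: cid. Qed.

(** All these matrices are diagonal in the basis a_1 - a_2 / (1 + alpha), a_2, a_3, with eigenvalues
    x, y and x y. *)
Lemma torusM : {morph torus : k l / (k * l)%g}.
Proof.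
move=> [a b] [c d]; apply: Xi_inj; rewrite XiM !Xi_torus lmxM /=.
by congr lmx; field.
Qed.

Lemma torus_inj : injective torus.
Proof.
move=> [a b] [c d] /(congr1 (@Xi F alpha)); rewrite !Xi_torus /=.
by case/lmx_inj=> [[ac _ _ bd] _]; congr (_, _); apply: val_inj.
Qed.

Lemma torus_bottom_diag k : torus k \in bottom_diag.
Proof. by rewrite (bottom_diagE (Xi_torus k)) eqxx. Qed.

(** The hypothesis is the determinant condition (p t - s q) z != 0 for s = 0 and z = p t, as
    [bottom_diagP] supplies it. *)
Lemma lower_torus x y : (x * y) * (x * y) != 0 ->
  exists k, Xi (torus k) = lmx x 0 ((y - x) / (1 + alpha)) y 0 0 (x * y).
Proof.
rewrite !mulf_eq0 orbb negb_or -!unitfE => /andP[xU yU].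
by exists (Units xU, Units yU); rewrite Xi_torus.
Qed.

Lemma isom_onto_torus : alpha != 1 -> isom_onto bottom_diag torus.
Proof.
move=> a1; split; [exact: torusM | exact: torus_inj | move=> g; split].
  move=> /bottom_diagP[p [s [q [t [z [e d gE]]]]]].
  have [[s0 qE zE]|[a1' _ _ _]] := aut_eqsP e d; last by rewrite a1' eqxx in a1.
  move: d; rewrite s0 mul0r subr0 zE => /lower_torus[k kE].
  by exists k; apply: Xi_inj; rewrite kE gE s0 qE zE.
by move=> [k <-]; apply: torus_bottom_diag.
Qed.

End AutL3.

(** * The case alpha = 1: the involution and the extended torus *)

Section AutL31.
Variable F : fieldType.
Hypothesis one_neqN1 : 1 != -1 :> F.
Local Notation G := (aut (L3 (1 : F))).

Let two_neq0 : 2 != 0 :> F. Proof. by rewrite addr_eq0. Qed.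
Local Notation tor := (torus one_neqN1).

(* Modulo a_3, the torus is diagonal in the basis a_1 - a_2 / 2, a_2; this
   involution exchanges the two eigenlines. *)
Lemma swap_ex : exists f : G, Xi f = L3_matB 1 0 0 0.
Proof.
apply: L3_aut_ex; first by split; ring.
rewrite mulr0 !mul1r subr0 mulr0 addr0 mulr1; by rewrite oppr_eq0 oner_neq0.
Qed.

Definition swap : G := projT1 (cid swap_ex).

Lemma Xi_swap : Xi swap = lmx 1 2 0 (-1) 0 0 1.
Proof.
rewrite /swap; case: cid => f /= ->; rewrite -/(lmx _ _ _ _ _ _ _).
by congr lmx; ring.
Qed.

Lemma swap2 : (swap * swap)%g = 1%g.
Proof.
apply: Xi_inj; rewrite XiM Xi_swap lmxM Xi1 -lmx1; congr lmx; ring.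
Qed.

Lemma swapV : (swap^-1)%g = swap.
Proof. by apply: (mulgI swap); rewrite mulgV swap2. Qed.

Lemma torus_swap x y : (tor (x, y) ^ swap)%g = tor (y, x).
Proof.
rewrite conjgE; apply: (mulgI swap); rewrite mulVKg; apply: Xi_inj.
rewrite !XiM !Xi_torus Xi_swap !lmxM /=.
by congr lmx; field.
Qed.

(** The (1, 2) entry is 0 on the torus and 2 on [swap], and 2 is nonzero in F. *)
Lemma swap_notin_torus k : tor k != swap.
Proof.
apply/eqP => /(congr1 (@Xi F 1)); rewrite Xi_torus Xi_swap.
by case/lmx_inj=> [[_ E _ _] _]; have := two_neq0; rewrite -E eqxx.
Qed.

Lemma swap_neq1 : swap != 1%g.
Proof.
by rewrite -(morph_id (@torusM _ _ one_neqN1)) eq_sym swap_notin_torus.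
Qed.

Lemma bottom_diag_cases (g : G) : g \in bottom_diag (alpha := 1) ->
  exists k, g = tor k \/ g = (tor k * swap)%g.
Proof.
move=> /bottom_diagP[p [s [q [t [z [e d gE]]]]]].
have [[s0 qE zE]|[_ sE tE zE]] := aut_eqsP one_neqN1 e d.
  move: d; rewrite s0 mul0r subr0 zE => /(lower_torus one_neqN1)[k kE].
  by exists k; left; apply: Xi_inj; rewrite kE gE s0 qE zE.
(* For g in family (B), [g * swap] is lower triangular with diagonal p, p + 2 q, z up to the sign of
   no entry, so it is the torus element with parameters p and p + 2 q. *)
have : (p * (p + 2 * q)) * (p * (p + 2 * q)) != 0.
  move: d; rewrite -zE mulf_eq0 negb_or => /andP[_ z0]; exact: mulf_neq0.
move=> /(lower_torus one_neqN1)[k kE].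
exists k; right; apply: Xi_inj; rewrite XiM kE gE Xi_swap lmxM sE tE zE.
by congr lmx; field.
Qed.

Lemma semidirect_swap :
  semidirect (bottom_diag (alpha := 1)) (image_pred tor) (pred2 1%g swap).
Proof.
have [oneH _] := @group_closed_bottom_diag F 1.
have swapH : swap \in bottom_diag (alpha := 1).
  by rewrite (bottom_diagE Xi_swap) eqxx.
have torM := @torusM _ _ one_neqN1.
have tor1 : 1%g \in image_pred tor by have [] := group_closed_image torM.
split; split.
- exact: group_closed_bottom_diag.
- exact: group_closed_image torM.
- by move=> _ /image_predP[k <-]; apply: torus_bottom_diag.
(* It suffices to conjugate by a torus element, which stays in the image of [tor], and then possibly
   by [swap], which exchanges the two parameters. *)
- move=> _ g /image_predP[k <-] /bottom_diag_cases[l gE].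
  have torJ : (tor k ^ tor l)%g = tor (k ^ l)%g.
    by rewrite !conjgE -(morph_inv torM) -!torM.
  case: gE => ->; first by rewrite torJ mem_image_pred.
  rewrite conjgM torJ; case: (k ^ l)%g => x y.
  by rewrite torus_swap mem_image_pred.
- split=> [|g h]; rewrite !inE ?eqxx //.
  move=> /pred2P[]-> /pred2P[]->;
    by rewrite ?swapV ?invg1 ?mulg1 ?mul1g ?swap2 eqxx ?orbT.
- by move=> g; rewrite !inE => /pred2P[]->.
- move=> _ /image_predP[k <-]; rewrite !inE => /pred2P[] // E.
  by have := swap_notin_torus k; rewrite E eqxx.
move=> g /bottom_diag_cases[k [->|->]].
- by exists (tor k), 1%g; rewrite mulg1 mem_image_pred !inE eqxx.
- by exists (tor k), swap; rewrite mem_image_pred !inE eqxx orbT.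
Qed.

End AutL31.

Theorem theorem3p1 (F : fieldType) (alpha : F)
    (alpha_neq0 : alpha != 0) (alpha_neqN1 : alpha != -1) :
  let G : groupType := aut (L3 alpha) in
  (alpha != 1 ->
     range (@Xi F alpha) = L3_matsA alpha /\
     exists N H : {pred G},
       [/\ isog_to N (Fadd F * Fadd F)%type,
           isog_to H (Fmul F * Fmul F)%type &
           semidirect predT N H]) /\
  (alpha = 1 ->
     [/\ 2%N \notin [pchar F],
         range (@Xi F alpha) = L3_matsA alpha `|` @L3_matsB F &
         exists N H : {pred G},
           [/\ isog_to N (Fadd F * Fadd F)%type,
               semidirect predT N H &
               exists (D C : {pred G}) (phi : Fmul F * Fmul F -> G) (s : G),
                 [/\ isom_onto D phi,
                     semidirect H D C,
                     s != 1%g,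
                     C =i pred2 1%g s &
                     forall x y : Fmul F, (phi (x, y) ^ s)%g = phi (y, x)]]]).
Proof.
cbv zeta; split=> [alpha_neq1|alpha1].
  split.
    apply/seteqP; split=> M.
      by move=> /range_XiP[] // [a1]; rewrite a1 eqxx in alpha_neq1.
    by move=> MA; apply/range_XiP => //; left.
  exists (image_pred (@trans F alpha)), (@bottom_diag F alpha); split.
  - by exists (@trans F alpha); apply/isom_onto_image/trans_inj/transM.
  - by exists (torus alpha_neqN1); apply: isom_onto_torus.
  - exact: semidirect_trans.
(* With alpha = 1, the hypothesis [alpha != -1] says that the characteristic is not 2. *)
subst alpha; have two0 : 2 != 0 :> F by move: alpha_neqN1; rewrite -addr_eq0.
split; first by rewrite inE negb_and two0 orbT.
  apply/seteqP; split=> M.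
    by move=> /(range_XiP alpha_neqN1 M)[|[_]]; [left | right].
  by move=> [MA|MB]; apply/(range_XiP alpha_neqN1 M); [left | right].
exists (image_pred (@trans F 1)), (@bottom_diag F 1); split.
- by exists (@trans F 1); apply/isom_onto_image/trans_inj/transM.
- exact: semidirect_trans.
exists (image_pred (torus alpha_neqN1)), (fun g => pred2 1%g (swap F) g).
exists (torus alpha_neqN1), (swap F); split=> //.
- exact/isom_onto_image/torus_inj/torusM.
- exact: semidirect_swap.
- exact: swap_neq1.
- exact: torus_swap.
Qed.
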